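(* Unless the Set Cover Conjecture is false, for no $\epsilon>0$ does \textsc{Dominator Coloring} admit an $O^*((2-\epsilon)^k)$-time algorithm, where $k$ is the size of a cluster vertex deletion set of the input graph.
   Context: Graphs are finite and simple; $N_G[v]=N_G(v)\cup\{v\}$. A dominator coloring of $G$ is a proper coloring in which every vertex $v$ dominates some color class (i.e., the class is contained in $N_G[v]$). \textsc{Dominator Coloring}: given $(G,\ell)$, decide whether $G$ has a dominator coloring with at most $\ell$ colors. A cluster vertex deletion set is $M\subseteq V(G)$ such that every component of $G-M$ is a clique. The Set Cover Conjecture (Cygan et al.) asserts that for every $\epsilon>0$ there is no $O^*((2-\epsilon)^n)$-time algorithm for \textsc{Set Cover} with universe of size $n$ (equivalently, for \textsc{Hitting Set} with $n$ sets). $O^*(\cdot)$ hides polynomial factors. *)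

(* Defs.v *)
From mathcomp Require Import all_boot all_order all_algebra reals.

Set Implicit Arguments.
Unset Strict Implicit.
Unset Printing Implicit Defensive.

Import Order.TTheory GRing.Theory Num.Theory.

(* Model of computation: the WHILE language over binary trees of N. D. Jones
   (Computability and Complexity from a Programming Perspective, 1997), with
   its unit-cost time measure.  Values are immutable and can be shared, so a
   RAM executes each primitive operation in O(1) time; conversely a tree
   program simulates T steps of a RAM in time T * polylog(T) by keeping the
   memory in a balanced tree.  For single-exponential T this overhead is
   polynomial in the input size, hence O^*(b^k) bounds do not depend on the
   choice between the two models. *)

Inductive tree := Leaf | Node of tree & tree.

Fixpoint tree_size (t : tree) : nat :=
  if t is Node l r then (tree_size l + tree_size r).+1 else 1.

Inductive expr :=
  | EVar of nat
  | ENil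
  | ECons of expr & expr
  | EHd of expr
  | ETl of expr.

Inductive cmd :=
  | Assign of nat & expr
  | Seq of cmd & cmd
  | If of expr & cmd & cmd
  | While of expr & cmd.

Definition store := nat -> tree.

Definition update (s : store) (x : nat) (v : tree) : store :=
  fun y => if y == x then v else s y.

Fixpoint eval (s : store) (e : expr) : tree :=
  match e with
  | EVar x => s x
  | ENil => Leaf
  | ECons e1 e2 => Node (eval s e1) (eval s e2)
  | EHd e1 => if eval s e1 is Node l _ then l else Leaf
  | ETl e1 => if eval s e1 is Node _ r then r else Leaf
  end.

Fixpoint expr_cost (e : expr) : nat :=
  match e with
  | EVar _ | ENil => 1
  | ECons e1 e2 => (expr_cost e1 + expr_cost e2).+1
  | EHd e1 | ETl e1 => (expr_cost e1).+1
  end.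

(* [exec c s t s'] : started in store [s], [c] halts after [t] elementary
   steps in store [s'].  [Leaf] is the truth value "false". *)
Inductive exec : cmd -> store -> nat -> store -> Prop :=
  | ExecAssign x e s :
      exec (Assign x e) s (expr_cost e).+1 (update s x (eval s e))
  | ExecSeq c1 c2 s1 s2 s3 t1 t2 :
      exec c1 s1 t1 s2 -> exec c2 s2 t2 s3 ->
      exec (Seq c1 c2) s1 (t1 + t2) s3
  | ExecIfTrue e c1 c2 s s' t :
      eval s e <> Leaf -> exec c1 s t s' ->
      exec (If e c1 c2) s ((expr_cost e).+1 + t) s'
  | ExecIfFalse e c1 c2 s s' t :
      eval s e = Leaf -> exec c2 s t s' ->
      exec (If e c1 c2) s ((expr_cost e).+1 + t) s'
  | ExecWhileTrue e c s1 s2 s3 t1 t2 :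
      eval s1 e <> Leaf -> exec c s1 t1 s2 -> exec (While e c) s2 t2 s3 ->
      exec (While e c) s1 ((expr_cost e).+1 + t1 + t2) s3
  | ExecWhileFalse e c s :
      eval s e = Leaf -> exec (While e c) s (expr_cost e).+1 s.

Lemma exec_det c s t s1 : exec c s t s1 ->
  forall t' s2, exec c s t' s2 -> t = t' /\ s1 = s2.
Proof.
elim=> {c s t s1} [x e s|c1 c2 s1 s2 s3 t1 t2 _ IH1 _ IH2|e c1 c2 s s' t e1 _ IH
  |e c1 c2 s s' t e0 _ IH|e c s1 s2 s3 t1 t2 e1 _ IH1 _ IH2|e c s e0] t' s4 H;
  inversion H; subst; repeat
    match goal with
    | IH : forall _ _, exec ?c ?s _ _ -> _, E : exec ?c ?s _ _ |- _ =>
        case: (IH _ _ E) => ? ?; subst; clear E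
    end; by [].
Qed.

Definition input_store (v : tree) : store := fun x => if x == 0 then v else Leaf.

(* [in_Ostar enc yes par b] : some program decides the problem with instances
   [I], encoding [enc] and yes-instances [yes] in time O^*(b^k), that is
   C * N^d * b^k with N the size of the encoded input.  [par i k] says that
   [k] is a parameter value of the instance [i]; the bound is required for
   every such [k]. *)
Definition in_Ostar (R : realType) (I : Type) (enc : I -> tree)
    (yes : I -> Prop) (par : I -> nat -> Prop) (b : R) : Prop :=
  exists (p : cmd) (C d : nat), forall i : I, exists (t : nat) (s : store),
    [/\ exec p (input_store (enc i)) t s,
        s 0 <> Leaf <-> yes i &
        forall k, par i k ->
          (t%:R <= C%:R * (tree_size (enc i))%:R ^+ d * b ^+ k)%R].

(* Numbers are written in unary: the budgets occurring below only matter up to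
   the number of vertices (resp. of sets), so this affects the running times
   by polynomial factors only. *)
Definition enc_nat (n : nat) : tree := iter n (Node Leaf) Leaf.
Definition enc_bool (b : bool) : tree := if b then Node Leaf Leaf else Leaf.
Definition enc_list (s : seq tree) : tree := foldr Node Leaf s.
Definition enc_row n (f : 'I_n -> bool) : tree :=
  enc_list [seq enc_bool (f j) | j <- enum 'I_n].
Definition enc_matrix m n (f : 'I_m -> 'I_n -> bool) : tree :=
  enc_list [seq enc_row (f i) | i <- enum 'I_m].

Record set_cover_instance := SetCoverInstance {
  sc_universe : nat;
  sc_nsets : nat;
  sc_family : 'I_sc_nsets -> {set 'I_sc_universe};
  sc_budget : nat
}.

Definition set_cover_yes (i : set_cover_instance) : Prop :=
  exists J : {set 'I_(sc_nsets i)},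
    #|J| <= sc_budget i /\ \bigcup_(j in J) sc_family j = [set: 'I_(sc_universe i)].

(* The universe size is not determined by the incidence matrix when the family
   is empty, hence is encoded separately. *)
Definition enc_set_cover (i : set_cover_instance) : tree :=
  Node (enc_nat (sc_budget i))
    (Node (enc_nat (sc_universe i))
       (enc_matrix (fun j x => x \in @sc_family i j))).

Definition set_cover_conjecture (R : realType) : Prop :=
  forall eps : R, (0 < eps)%R ->
    ~ in_Ostar enc_set_cover set_cover_yes
        (fun i k => k = sc_universe i) (2 - eps)%R.

Record graph := Graph {
  gorder : nat;
  adj : rel 'I_gorder;
  adj_sym : symmetric adj;
  adj_irr : irreflexive adj
}.

Definition closed_nbhd (G : graph) (v : 'I_(gorder G)) : {set 'I_(gorder G)} :=
  v |: [set u | adj v u].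

Definition color_class (G : graph) l (f : 'I_(gorder G) -> 'I_l) (c : 'I_l) :
  {set 'I_(gorder G)} := [set u | f u == c].

(* Color classes are nonempty: an unused color is dominated by no vertex. *)
Definition dominator_coloring (G : graph) l (f : 'I_(gorder G) -> 'I_l) : Prop :=
  (forall u v, adj u v -> f u <> f v) /\
  (forall v, exists c, color_class f c != set0 /\
                       color_class f c \subset closed_nbhd v).

Definition deleted_adj (G : graph) (M : {set 'I_(gorder G)}) : rel 'I_(gorder G) :=
  [rel u v | [&& adj u v, u \notin M & v \notin M]].

Definition cvd_set (G : graph) (M : {set 'I_(gorder G)}) : Prop :=
  forall u v, u \notin M -> v \notin M ->
    connect (deleted_adj M) u v -> u != v -> adj u v.

Definition dc_instance := (graph * nat)%type.

Definition dc_yes (i : dc_instance) : Prop :=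
  exists f : 'I_(gorder i.1) -> 'I_(i.2), dominator_coloring f.

Definition enc_dc (i : dc_instance) : tree :=
  Node (enc_nat i.2) (enc_matrix (@adj i.1)).

Definition dc_cvd_size (i : dc_instance) (k : nat) : Prop :=
  exists M : {set 'I_(gorder i.1)}, cvd_set M /\ #|M| = k.

(* The same problem with a cluster vertex deletion set supplied in the input. *)
Record dc_cvd_instance := DcCvdInstance {
  dcm_instance : dc_instance;
  dcm_set : {set 'I_(gorder dcm_instance.1)};
  dcm_set_cvd : cvd_set dcm_set
}.

Definition enc_dc_cvd (i : dc_cvd_instance) : tree :=
  Node (enc_row (fun v => v \in dcm_set i)) (enc_dc (dcm_instance i)).

(* Main.v *)
Require Import Defs.
From mathcomp Require Import all_boot all_order all_algebra reals.
From mathcomp Require Import boolp zify.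

(* Given a set cover instance with universe of size n, add an empty set to the
   family and build the graph whose vertices are the sets, the elements and two
   hubs: an element is adjacent to the sets containing it, and the hubs are
   adjacent to each other and to all the sets.  Deleting the elements and the
   hubs leaves isolated vertices, so k = n + 2.

   A cover of size t yields a dominator coloring with t + 3 colours: one for
   each chosen set, one for the other sets, one for the first hub, one for the
   second hub and the elements.  Conversely the hubs and the empty set form a
   triangle whose three colour classes are dominated by no element; a class
   dominated by an element x is {x} or consists of sets containing x, so the
   remaining t classes yield a cover, provided every element lies in some set.
   Otherwise the number of colours is set to 0.

   The graph is computed by a quadratic-time WHILE program.  A base b < 1 is
   replaced by 1, and b <= 0 is impossible because running times are positive. *)

Set Implicit Arguments.
Unset Strict Implicit.
Unset Printing Implicit Defensive.

Import Order.TTheory GRing.Theory Num.Theory.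

Definition regs (l : seq tree) : store := nth Leaf l.

Definition run (c : cmd) (l l' : seq tree) (T : nat) : Prop :=
  exists2 t, t <= T & exec c (regs l) t (regs l').

Lemma update_regs l x v : update (regs l) x v = regs (set_nth Leaf l x v).
Proof. by apply/funext => y; rewrite /update /regs nth_set_nth. Qed.

Lemma run_assign x e l l' :
  set_nth Leaf l x (eval (regs l) e) = l' ->
  run (Assign x e) l l' (expr_cost e).+1.
Proof. by move=> <-; eexists; last by rewrite -update_regs; exact: ExecAssign. Qed.

Lemma run_seq c1 c2 l1 l2 l3 T1 T2 :
  run c1 l1 l2 T1 -> run c2 l2 l3 T2 -> run (Seq c1 c2) l1 l3 (T1 + T2).
Proof.
move=> [t1 le1 ex1] [t2 le2 ex2]; exists (t1 + t2); first exact: leq_add.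
exact: ExecSeq ex1 ex2.
Qed.

Lemma run_le c l l' T T' : run c l l' T -> T <= T' -> run c l l' T'.
Proof. by move=> [t le_t ex_t] le_T; exists t => //; apply: leq_trans le_T. Qed.

Lemma run_if (b : bool) e c1 c2 l l' T :
  eval (regs l) e = enc_bool b ->
  run (if b then c1 else c2) l l' T ->
  run (If e c1 c2) l l' ((expr_cost e).+1 + T).
Proof.
case: b => eb [t le_t ex_t]; exists ((expr_cost e).+1 + t); rewrite ?leq_add2l //.
- by apply: ExecIfTrue => //; rewrite eb.
- exact: ExecIfFalse.
Qed.

Lemma run_foreach (A B : Type) (P : A -> Prop) (step : B -> A -> B)
    (S : seq A -> B -> seq tree) e c T s b :
  (forall b, eval (regs (S [::] b)) e = Leaf) ->
  (forall a s b, eval (regs (S (a :: s) b)) e <> Leaf) ->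
  (forall a s b, P a -> run c (S (a :: s) b) (S s (step b a)) T) ->
  List.Forall P s ->
  run (While e c) (S s b) (S [::] (foldl step b s))
      (size s * ((expr_cost e).+1 + T) + (expr_cost e).+1).
Proof.
move=> Snil Scons body; elim: s b => [|a s IHs] b.
  by move=> _; exists (expr_cost e).+1; last exact: ExecWhileFalse.
move=> /List.Forall_cons_iff[Pa Ps].
have [t1 le1 ex1] := body a s b Pa; have [t2 le2 ex2] := IHs (step b a) Ps.
exists ((expr_cost e).+1 + t1 + t2); first by rewrite /=; lia.
exact: ExecWhileTrue (Scons a s b) ex1 ex2.
Qed.

Declare Scope cmd_scope.
Delimit Scope cmd_scope with cmd.
Bind Scope cmd_scope with cmd.
Local Notation "x <~ e" := (Assign x e) (at level 60) : cmd_scope.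
Local Notation "c1 ;; c2" := (Seq c1 c2) (at level 62, right associativity) : cmd_scope.
Local Notation "# x" := (EVar x) (at level 3, format "# x") : cmd_scope.
Local Notation ETrue := (ECons ENil ENil).

(* Registers: 0 set rows, 1 number of colours, 2 universe size, 3 outer
   iterator, 4 element rows and finally the whole matrix, 6 and 7 the hub rows,
   9 the deletion set; 5 and 8 are scratch. *)
Definition init_prog : cmd := (
  1 <~ ECons ENil (ECons ENil (ECons ENil (EHd #0))) ;;
  2 <~ EHd (ETl #0) ;;
  0 <~ ECons #2 (ETl (ETl #0)) ;;
  6 <~ ECons ENil (ECons ETrue #2) ;;
  7 <~ ECons ETrue (ECons ENil #2) ;;
  3 <~ #2 ;;
  While #3 (4 <~ ECons (ECons ENil (ECons ENil #2)) #4 ;;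
            9 <~ ECons ETrue #9 ;;
            3 <~ ETl #3) ;;
  9 <~ ECons ETrue (ECons ETrue #9))%cmd.

Definition zip_prog : cmd := (
  5 <~ EHd #3 ;;
  While #5 (8 <~ ECons (ECons (EHd #5) (EHd #4)) #8 ;;
            4 <~ ETl #4 ;;
            5 <~ ETl #5) ;;
  While #8 (4 <~ ECons (EHd #8) #4 ;;
            8 <~ ETl #8))%cmd.

Definition columns_prog : cmd := (
  3 <~ #0 ;;
  While #3 (zip_prog ;;
            6 <~ ECons ETrue #6 ;;
            7 <~ ECons ETrue #7 ;;
            9 <~ ECons ENil #9 ;;
            3 <~ ETl #3))%cmd.

Definition cover_prog : cmd := (
  3 <~ #4 ;;
  While #3 (5 <~ EHd #3 ;;
            While #5 (If (EHd #5) (8 <~ ETrue) (8 <~ #8) ;;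
                      5 <~ ETl #5) ;;
            If #8 (8 <~ ENil) (1 <~ ENil) ;;
            3 <~ ETl #3))%cmd.

Definition rows_prog : cmd := (
  4 <~ ECons #6 (ECons #7 #4) ;;
  3 <~ #0 ;;
  While #3 (5 <~ ECons ETrue (ECons ETrue (EHd #3)) ;;
            8 <~ #0 ;;
            While #8 (5 <~ ECons ENil #5 ;;
                      8 <~ ETl #8) ;;
            4 <~ ECons #5 #4 ;;
            5 <~ ENil ;;
            3 <~ ETl #3))%cmd.

Definition output_prog (e : expr) : cmd := (
  0 <~ e ;;
  1 <~ ENil ;; 2 <~ ENil ;; 4 <~ ENil ;;
  6 <~ ENil ;; 7 <~ ENil ;; 9 <~ ENil)%cmd.

Definition reduction_prog (e : expr) : cmd :=
  (init_prog ;; columns_prog ;; cover_prog ;; rows_prog ;; output_prog e)%cmd.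

Definition enc_bits (r : seq bool) : tree := enc_list (map enc_bool r).
Definition enc_rows (s : seq (seq bool)) : tree := enc_list (map enc_bits s).

Lemma enc_nat_bits n : enc_nat n = enc_bits (nseq n false).
Proof. by elim: n => //= n ->. Qed.

Lemma Forall_all T (P : pred T) s : all P s -> List.Forall P s.
Proof. by elim: s => [|x s IHs] //= /andP[Px /IHs]; constructor. Qed.

Lemma Forall_True T (s : seq T) : List.Forall (fun=> True) s.
Proof. by elim: s; constructor. Qed.

Ltac run_step :=
  eapply run_assign; cbn [set_nth eval regs nth]; reflexivity.
Ltac run_steps := repeat (eapply run_seq; [run_step|]).

Ltac run_loop P step S s b :=
  eapply (@run_foreach _ _ P step S _ _ _ s b);
  [by [] | by [] | | try exact: Forall_True].

Lemma foldl_iter A (T : Type) (f : T -> T) (z : T) (s : seq A) :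
  foldl (fun x _ => f x) z s = iter (size s) f z.
Proof. by elim: s z => //= a s IHs z; rewrite IHs -iterSr. Qed.

Lemma iter_pair A B (f : A -> A) (g : B -> B) k a b :
  iter k (fun p => (f p.1, g p.2)) (a, b) = (iter k f a, iter k g b).
Proof. by elim: k => //= k ->. Qed.

Lemma iter_cons A (x : A) k s : iter k (cons x) s = nseq k x ++ s.
Proof. by elim: k => //= k ->. Qed.

Lemma run_init t n (rows : seq (seq bool)) :
  run init_prog
   [:: Node (enc_nat t) (Node (enc_bits (nseq n false)) (enc_rows rows));
       Leaf; Leaf; Leaf; Leaf; Leaf; Leaf; Leaf; Leaf; Leaf]
   [:: enc_rows (nseq n false :: rows); enc_nat t.+3; enc_bits (nseq n false);
       Leaf; enc_rows (nseq n (nseq n.+2 false)); Leaf;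
       enc_bits (false :: true :: nseq n false);
       enc_bits (true :: false :: nseq n false); Leaf;
       enc_bits (nseq n.+2 true)] (26 * n + 60).
Proof.
pose S (s : seq bool) (b : seq (seq bool) * seq bool) :=
  [:: enc_rows (nseq n false :: rows); enc_nat t.+3; enc_bits (nseq n false);
      enc_bits s; enc_rows b.1; Leaf; enc_bits (false :: true :: nseq n false);
      enc_bits (true :: false :: nseq n false); Leaf; enc_bits b.2].
pose step (b : seq (seq bool) * seq bool) (_ : bool) :=
  (nseq n.+2 false :: b.1, true :: b.2).
apply: run_le.
  rewrite /init_prog; run_steps.
  eapply run_seq.
    run_loop (fun _ : bool => True) step S (nseq n false)
      (@nil (seq bool), @nil bool).
    by move=> a s b _; run_steps; run_step.
  eapply run_assign; rewrite foldl_iter iter_pair !iter_cons !cats0 size_nseq.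
  reflexivity.
by rewrite size_nseq /=; lia.
Qed.

Definition zip_step (cols : seq (seq bool)) (r : seq bool) :=
  [seq p.1 :: p.2 | p <- zip r cols].

Lemma run_zip n a0 a1 a2 a6 a7 a9 (row : seq bool) rest cols :
  size row = n -> size cols = n ->
  run zip_prog
   [:: a0; a1; a2; enc_rows (row :: rest); enc_rows cols; Leaf; a6; a7; Leaf; a9]
   [:: a0; a1; a2; enc_rows (row :: rest); enc_rows (zip_step cols row); Leaf; a6; a7;
       Leaf; a9] (30 * n + 30).
Proof.
move=> size_row size_cols.
pose S (s : seq bool) (b : seq (seq bool) * seq (seq bool)) :=
  [:: a0; a1; a2; enc_rows (row :: rest); enc_rows b.1; enc_bits s; a6; a7;
      enc_rows b.2; a9].
pose step (b : seq (seq bool) * seq (seq bool)) (a : bool) :=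
  (behead b.1, (a :: head [::] b.1) :: b.2).
have steps s c d : size s = size c ->
    foldl step (c, d) s = ([::], catrev (zip_step c s) d).
  by elim: s c d => [|a s IHs] [|x c] d //= [sz]; rewrite IHs.
pose S' (s : seq (seq bool)) (b : seq (seq bool)) :=
  [:: a0; a1; a2; enc_rows (row :: rest); enc_rows b; Leaf; a6; a7;
      enc_rows s; a9].
pose step' (b : seq (seq bool)) (a : seq bool) := a :: b.
have steps' s c : foldl step' c s = catrev s c by elim: s c => //= a s IHs c.
apply: run_le.
  rewrite /zip_prog; run_steps.
  eapply run_seq.
    run_loop (fun _ : bool => True) step S row (cols, @nil (seq bool)).
    move=> a s [[|c cols'] d] _; run_steps; run_step.
  rewrite steps ?size_row ?size_cols // -/(rev _).
  have -> : enc_rows (zip_step cols row) =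
    enc_rows (foldl step' [::] (rev (zip_step cols row))).
    by rewrite steps' -/(rev _) revK.
  run_loop (fun _ : seq bool => True) step' S' (rev (zip_step cols row))
     (@nil (seq bool)).
  by move=> a s b _; run_steps; run_step.
by rewrite size_rev size_map size_zip size_row size_cols /=; lia.
Qed.

(* The element rows once the set rows in [p] have been consed onto them, the
   last one first: hence the sets appear in reverse order in the graph. *)
Definition element_rows n (p : seq (seq bool)) : seq (seq bool) :=
  [seq [seq nth false r x | r <- p] ++ nseq n.+2 false | x <- iota 0 n].

Lemma element_rows0 n : element_rows n [::] = nseq n (nseq n.+2 false).
Proof.
by rewrite /element_rows; elim: {2 3}n 0 => //= k IHk i; rewrite IHk.
Qed.

Lemma zip_step_element_rows n p r :
  size r = n -> zip_step (element_rows n p) r = element_rows n (r :: p).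
Proof.
move=> size_r; apply: (@eq_from_nth _ [::]).
  by rewrite !size_map size_zip size_map size_iota size_r minnn.
rewrite size_map size_zip size_map size_iota size_r minnn => x lt_x.
rewrite (nth_map (false, [::])) ?size_zip ?size_map ?size_iota ?size_r ?minnn //.
rewrite nth_zip ?size_map ?size_iota //=.
by rewrite !(nth_map 0) ?size_iota // nth_iota.
Qed.

Lemma foldl_cons A (s b : seq A) : foldl (fun x a => a :: x) b s = catrev s b.
Proof. by elim: s b => //= a s IHs b; rewrite IHs. Qed.

Lemma run_columns n a1 a2 (rows : seq (seq bool)) (g w k : seq bool) :
  all (fun r => size r == n) rows ->
  run columns_prog
   [:: enc_rows rows; a1; a2; Leaf; enc_rows (element_rows n [::]); Leaf;
       enc_bits g; enc_bits w; Leaf; enc_bits k]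
   [:: enc_rows rows; a1; a2; Leaf; enc_rows (element_rows n (rev rows)); Leaf;
       enc_bits (nseq (size rows) true ++ g);
       enc_bits (nseq (size rows) true ++ w); Leaf;
       enc_bits (nseq (size rows) false ++ k)]
   (size rows * (30 * n + 60) + 10).
Proof.
move=> size_rows.
pose S (s p : seq (seq bool)) :=
  [:: enc_rows rows; a1; a2; enc_rows s; enc_rows (element_rows n p); Leaf;
      enc_bits (nseq (size p) true ++ g); enc_bits (nseq (size p) true ++ w);
      Leaf; enc_bits (nseq (size p) false ++ k)].
rewrite -[size rows in X in run _ _ X]size_rev.
have -> : rev rows = foldl (fun x a => a :: x) [::] rows by rewrite foldl_cons.
apply: run_le.
  rewrite /columns_prog; run_steps.
  run_loop (fun r : seq bool => size r == n) (fun x (a : seq bool) => a :: x) S rows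
    (@nil (seq bool)); last exact: Forall_all.
  move=> r s p /eqP size_r.
  eapply run_seq.
    apply: run_zip; first exact: size_r.
    by rewrite size_map size_iota.
  rewrite zip_step_element_rows //.
  by run_steps; run_step.
by rewrite /=; lia.
Qed.

Lemma foldl_orb (s : seq bool) b : foldl orb b s = b || has id s.
Proof. by elim: s b => [|a s IHs] b /=; rewrite ?orbF // IHs orbA. Qed.

Lemma foldl_and_all A (P : pred A) s b : foldl (fun x a => x && P a) b s = b && all P s.
Proof. by elim: s b => [|a s IHs] b /=; rewrite ?andbT // IHs andbA. Qed.

Lemma run_cover l k a0 a2 a6 a7 a9 (cols : seq (seq bool)) :
  all (fun r => size r == k) cols ->
  run cover_prog
   [:: a0; enc_nat l; a2; Leaf; enc_rows cols; Leaf; a6; a7; Leaf; a9]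
   [:: a0; enc_nat (if all (has id) cols then l else 0); a2; Leaf;
       enc_rows cols; Leaf; a6; a7; Leaf; a9]
   (size cols * (30 * k + 40) + 10).
Proof.
move=> size_cols.
pose S (s : seq (seq bool)) (b : bool) :=
  [:: a0; enc_nat (if b then l else 0); a2; enc_rows s;
       enc_rows cols; Leaf; a6; a7; Leaf; a9].
rewrite -[all _ _]andTb -foldl_and_all.
apply: run_le.
  rewrite /cover_prog; run_steps.
  run_loop (fun r : seq bool => size r == k) (fun x (a : seq bool) => x && has id a)
    S cols true; last exact: Forall_all.
  move=> r s b /eqP size_r.
  pose S' (s' : seq bool) (f : bool) :=
    [:: a0; enc_nat (if b then l else 0); a2; enc_rows (r :: s);
       enc_rows cols; enc_bits s'; a6; a7; enc_bool f; a9].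
  run_steps.
  eapply run_seq.
    apply: run_le.
      run_loop (fun _ : bool => True) orb S' r false.
      move=> a s' f _.
      apply: (@run_seq _ _ _ (S' (a :: s') (f || a))); last run_step.
      apply: (@run_if a _ _ _ _ _ 4) => //.
      by case: a; rewrite ?orbT ?orbF; cbv iota; (apply: run_le; [run_step|]).
    by rewrite size_r; exact: leqnn.
  rewrite foldl_orb orFb.
  apply: (@run_seq _ _ _ (S (r :: s) (b && has id r))); last run_step.
  apply: (@run_if (has id r) _ _ _ _ _ 3) => //.
  by case: (has id r); rewrite ?andbT ?andbF; cbv iota;
    (apply: run_le; [run_step|]).
by rewrite /=; lia.
Qed.

Definition set_row m (r : seq bool) := nseq m false ++ true :: true :: r.

Lemma run_rows a1 a2 a9 (rows cols : seq (seq bool)) (g w : seq bool) :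
  run rows_prog
   [:: enc_rows rows; a1; a2; Leaf; enc_rows cols; Leaf; enc_bits g; enc_bits w;
       Leaf; a9]
   [:: enc_rows rows; a1; a2; Leaf;
       enc_rows (map (set_row (size rows)) (rev rows) ++ g :: w :: cols); Leaf;
       enc_bits g; enc_bits w; Leaf; a9]
   (size rows * (20 * size rows + 60) + 20).
Proof.
pose S (s : seq (seq bool)) (b : seq (seq bool)) :=
  [:: enc_rows rows; a1; a2; enc_rows s; enc_rows b; Leaf;
       enc_bits g; enc_bits w; Leaf; a9].
have steps s b : foldl (fun x r => set_row (size rows) r :: x) b s =
    map (set_row (size rows)) (rev s) ++ b.
  elim: s b => //= r s IHs b.
  by rewrite IHs rev_cons map_rcons cat_rcons.
rewrite -steps; apply: run_le.
  rewrite /rows_prog; run_steps.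
  run_loop (fun _ : seq bool => True) (fun x r => set_row (size rows) r :: x)
    S rows (g :: w :: cols).
  move=> r s b _.
  pose S' (s' : seq (seq bool)) (f : seq bool) :=
    [:: enc_rows rows; a1; a2; enc_rows (r :: s); enc_rows b; enc_bits f;
       enc_bits g; enc_bits w; enc_rows s'; a9].
  run_steps.
  eapply run_seq.
    run_loop (fun _ : seq bool => True) (fun x (_ : seq bool) => false :: x) S' rows
      (true :: true :: r).
    by move=> a s' f _; run_steps; run_step.
  rewrite foldl_iter iter_cons.
  by run_steps; run_step.
by rewrite /=; lia.
Qed.

Definition red_budget n t rows :=
  if all (has id) (element_rows n (rev rows)) then t.+3 else 0.

Definition red_matrix n (rows : seq (seq bool)) : seq (seq bool) :=
  map (set_row (size rows)) (rev rows)
    ++ (nseq (size rows) true ++ false :: true :: nseq n false)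
    :: (nseq (size rows) true ++ true :: false :: nseq n false)
    :: element_rows n (rev rows).

Definition red_mask m n := nseq m false ++ nseq n.+2 true.

Definition dc_expr : expr := ECons (EVar 1) (EVar 4).
Definition dc_cvd_expr : expr := ECons (EVar 9) dc_expr.

Lemma run_reduction t n (rows : seq (seq bool)) (cvd : bool) :
  let rows' := nseq n false :: rows in
  let dc := Node (enc_nat (red_budget n t rows')) (enc_rows (red_matrix n rows')) in
  all (fun r => size r == n) rows ->
  exists2 t0, t0 <= 400 * (size rows + n + 3) ^ 2 &
  exec (reduction_prog (if cvd then dc_cvd_expr else dc_expr))
   (input_store (Node (enc_nat t) (Node (enc_nat n) (enc_rows rows)))) t0
   (input_store (if cvd then Node (enc_bits (red_mask (size rows') n)) dc else dc)).
Proof.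
move=> rows' dc size_rows.
have store_regs v : input_store v =
    regs [:: v; Leaf; Leaf; Leaf; Leaf; Leaf; Leaf; Leaf; Leaf; Leaf].
  by apply/funext => -[|[|[|[|[|[|[|[|[|[|y]]]]]]]]]] //=; rewrite /regs /= nth_nil.
rewrite !store_regs (enc_nat_bits n).
have size_rows' : all (fun r => size r == n) rows'.
  by rewrite /= size_nseq eqxx.
apply: run_le.
  rewrite /reduction_prog.
  eapply run_seq; [exact: run_init|].
  rewrite -element_rows0.
  eapply run_seq; [exact: run_columns|].
  eapply run_seq.
    apply: (@run_cover _ (size rows' + n.+2)).
    apply/allP => _ /mapP[x _ ->].
    by rewrite size_cat size_map size_rev size_nseq.
  eapply run_seq; [exact: run_rows|].
  by case: cvd; (apply: (@run_le _ _ _ _ 18); [run_steps; run_step|]).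
rewrite size_map size_iota /=.
nia.
Qed.

(* Vertices: the sets [0 .. m-1], the two hubs [m] and [m.+1], and the elements
   from [m.+2] on. *)
Definition red_edge m (inc : nat -> nat -> bool) : rel nat := fun i j =>
  (i < m) && ((m <= j < m.+2) || (m.+2 <= j) && inc i (j - m.+2))
  || (i == m) && (j == m.+1).

Definition red_adj m inc : rel nat :=
  fun i j => red_edge m inc i j || red_edge m inc j i.

Lemma red_adj_lt m inc i j : i < m -> j < m -> red_adj m inc i j = false.
Proof. by rewrite /red_adj /red_edge; lia. Qed.

Lemma red_adj_sym m n inc :
  symmetric (fun i j : 'I_(m + (2 + n)) => red_adj m inc i j).
Proof. by move=> i j; rewrite /red_adj orbC. Qed.

Lemma red_adj_irr m n inc :
  irreflexive (fun i j : 'I_(m + (2 + n)) => red_adj m inc i j).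
Proof. by move=> i; rewrite /red_adj /red_edge; lia. Qed.

Definition red_graph m n inc : graph :=
  Graph (@red_adj_sym m n inc) (@red_adj_irr m n inc).

Section RedGraph.

Variables (m n : nat) (inc : nat -> nat -> bool).
Let G := red_graph m n inc.
Let setv (j : 'I_m) : 'I_(gorder G) := lshift (2 + n) j.
Let hub (b : 'I_2) : 'I_(gorder G) := rshift m (lshift n b).
Let elt (x : 'I_n) : 'I_(gorder G) := rshift m (rshift 2 x).

Variant vertex_spec : 'I_(gorder G) -> Type :=
  | VertexSet j : vertex_spec (setv j)
  | VertexHub b : vertex_spec (hub b)
  | VertexElt x : vertex_spec (elt x).

Lemma vertexP v : vertex_spec v.
Proof.
case: (split_ordP v) => [j ->|w ->]; first exact: VertexSet.
by case: (split_ordP w) => [b ->|x ->]; [exact: VertexHub|exact: VertexElt].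
Qed.

Lemma adj_set_set i j : adj (setv i) (setv j) = false.
Proof. by rewrite /= red_adj_lt /=. Qed.

Lemma adj_set_hub i b : adj (setv i) (hub b).
Proof.
by have := ltn_ord i; have := ltn_ord b; rewrite /= /red_adj /red_edge /=; lia.
Qed.

Lemma adj_set_elt i x : adj (setv i) (elt x) = inc i x.
Proof.
have lt_i := ltn_ord i; rewrite /= /red_adj /red_edge /=.
have -> : m + (2 + x) - m.+2 = x by lia.
by case: (inc i x); lia.
Qed.

Lemma adj_hub_hub b c : adj (hub b) (hub c) = (b != c).
Proof.
have lt_b := ltn_ord b; have lt_c := ltn_ord c; rewrite /= /red_adj /red_edge /=.
by rewrite -val_eqE /=; lia.
Qed.

Lemma adj_hub_elt b x : adj (hub b) (elt x) = false.
Proof. by have := ltn_ord b; rewrite /= /red_adj /red_edge /=; lia. Qed.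

Lemma adj_elt_elt x y : adj (elt x) (elt y) = false.
Proof. by rewrite /= /red_adj /red_edge /=; lia. Qed.

Let adjE := (adj_set_set, adj_set_hub, adj_set_elt, adj_hub_hub, adj_hub_elt,
  adj_elt_elt).

Lemma setv_inj : injective setv. Proof. exact: lshift_inj. Qed.

Lemma elt_inj : injective elt.
Proof. by move=> x y /rshift_inj /rshift_inj. Qed.

Lemma setv_eq_elt j x : (setv j == elt x) = false.
Proof. by rewrite -val_eqE /=; have := ltn_ord j; lia. Qed.

Lemma hub_eq_elt b x : (hub b == elt x) = false.
Proof. by rewrite -val_eqE /=; have := ltn_ord b; lia. Qed.

Lemma closed_nbhd_elt x v : v \in closed_nbhd (elt x) ->
  v = elt x \/ exists2 j, v = setv j & inc j x.
Proof.
rewrite !inE; case: (vertexP v) => [j|b|y].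
- by rewrite setv_eq_elt adj_sym adjE /= => ?; right; exists j.
- by rewrite hub_eq_elt adj_sym adjE.
- by rewrite adjE orbF => /eqP; left.
Qed.

Definition covers (J : {set 'I_m}) : Prop :=
  forall x : 'I_n, exists2 j, j \in J & inc j x.

Lemma cover_dominator_coloring t (J : {set 'I_m}) :
  #|J| <= t -> covers J -> exists f : 'I_(gorder G) -> 'I_t.+3, dominator_coloring f.
Proof.
move=> leJ covJ.
pose fs (j : 'I_m) := if j \in J then index j (enum J) else t.
have fs_lt j : j \in J -> fs j < t.
  by move=> Jj; rewrite /fs Jj (leq_trans _ leJ) // cardE index_mem mem_enum.
have fs_le j : fs j <= t.
  by case: (boolP (j \in J)) => [/fs_lt/ltnW //|nJ]; rewrite /fs (negbTE nJ).
pose fn (v : 'I_(gorder G)) : nat := match split v with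
  | inl j => fs j
  | inr w => if w == 0 :> nat then t.+1 else t.+2 end.
have fn_set j : fn (setv j) = fs j by rewrite /fn (unsplitK (inl j)).
have fn_hub b : fn (hub b) = t.+1 + b.
  rewrite /fn (unsplitK (inr (lshift n b))) /=.
  by case: b => -[|[|b]] //= _; rewrite ?addn0 ?addn1.
have fn_elt x : fn (elt x) = t.+2 by rewrite /fn (unsplitK (inr (rshift 2 x))).
pose f v : 'I_t.+3 := inord (fn v).
have fE v : f v = fn v :> nat.
  rewrite inordK //; case: (vertexP v) => [j|b|x].
  - by rewrite fn_set; have := fs_le j; lia.
  - by rewrite fn_hub; have := ltn_ord b; lia.
  - by rewrite fn_elt.
exists f; split.
  move=> u v auv /(congr1 val); rewrite /= !fE; move: auv.
  have lt2 (b : 'I_2) := ltn_ord b.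
  case: (vertexP u) => [j|b|x]; case: (vertexP v) => [j'|b'|x'];
    rewrite ?adjE ?[adj (hub _) (setv _)]adj_sym ?[adj (elt _) (setv _)]adj_sym
      ?[adj (elt _) (hub _)]adj_sym ?adjE ?fn_set ?fn_hub ?fn_elt //.
  - by have := fs_le j; lia.
  - by have := fs_le j; lia.
  - by have := fs_le j'; lia.
  - by move=> + /addnI/val_inj eq_b; rewrite eq_b eqxx.
  - by have := fs_le j'; lia.
have hub0 v : f v = inord t.+1 -> v = hub ord0.
  move/(congr1 val); rewrite /= fE inordK //; case: (vertexP v) => [j|b|x].
  - by rewrite fn_set; have := fs_le j; lia.
  - by rewrite fn_hub => /eqP e; congr hub; apply: val_inj => /=; lia.
  - by rewrite fn_elt; lia.
have dom_hub v : hub ord0 \in closed_nbhd v -> exists c,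
    color_class f c != set0 /\ color_class f c \subset closed_nbhd v.
  move=> inv; exists (inord t.+1); split.
    apply/set0Pn; exists (hub ord0); rewrite inE; apply/eqP/val_inj.
    by rewrite /= fE fn_hub inordK // addn0.
  by apply/subsetP => u; rewrite inE => /eqP/hub0 ->.
move=> v; case: (vertexP v) => [j|b|x].
- by apply: dom_hub; rewrite !inE adjE orbT.
- apply: dom_hub; rewrite !inE adjE eq_sym.
  by case: (eqVneq b ord0) => [->|]; rewrite ?eqxx ?orbT.
have [j Jj jx] := covJ x; exists (f (setv j)); split.
  by apply/set0Pn; exists (setv j); rewrite inE.
apply/subsetP => u; rewrite inE => /eqP/(congr1 val); rewrite /= !fE fn_set.
have := fs_lt _ Jj; case: (vertexP u) => [i|b|y].
- rewrite fn_set => lt_t eq_fs; suff <- : j = i by rewrite !inE adj_sym adjE jx orbT.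
  have Ji : i \in J by apply: contraTT lt_t => nJ; rewrite -eq_fs /fs (negbTE nJ) ltnn.
  move: eq_fs; rewrite /fs Ji Jj => /(congr1 (nth j (enum J))).
  by rewrite !nth_index ?mem_enum.
- by rewrite fn_hub; lia.
- by rewrite fn_elt; lia.
Qed.

Lemma dominator_coloring_cover t (j0 : 'I_m) (f : 'I_(gorder G) -> 'I_t.+3) :
  (forall x : 'I_n, ~~ inc j0 x) -> covers [set: 'I_m] -> dominator_coloring f ->
  exists2 J : {set 'I_m}, #|J| <= t & covers J.
Proof.
move=> inc0 covT [proper_f dom_f].
pose forbidden := [set f (setv j0); f (hub ord0); f (hub ord_max)].
have card_forbidden : #|forbidden| = 3.
  have nf u v : adj u v -> f u != f v by move/proper_f/eqP.
  have h1 := nf _ _ (adj_set_hub j0 ord0).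
  have h2 := nf _ _ (adj_set_hub j0 ord_max).
  have h3 : f (hub ord0) != f (hub ord_max) by apply: nf; rewrite adj_hub_hub.
  rewrite /forbidden setUC cardsU1 !inE cards2 h1.
  by rewrite ![f (hub ord_max) == _]eq_sym (negbTE h2) (negbTE h3).
pose sets_of (c : 'I_t.+3) : 'I_m :=
  if [pick j | f (setv j) == c] is Some j then j
  else if [pick p : 'I_n * 'I_m | (f (elt p.1) == c) && inc p.2 p.1] is Some p
  then p.2 else j0.
exists (sets_of @: ~: forbidden).
  rewrite (leq_trans (leq_imset_card _ _)) // cardsCs setCK card_ord card_forbidden.
  by rewrite subSS subSS subSS subn0.
move=> x; have [c [/set0Pn[u]]] := dom_f (elt x); rewrite inE => /eqP fu sub_c.
have inx v : f v = c -> v = elt x \/ exists2 j, v = setv j & inc j x.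
  by move=> fv; apply: closed_nbhd_elt; apply: (subsetP sub_c); rewrite inE fv.
exists (sets_of c).
  apply: imset_f; rewrite !inE; apply/negP => /orP[/orP[]|] /eqP/esym/inx [].
  - by move/eqP; rewrite setv_eq_elt.
  - by case=> j /setv_inj <-; apply/negP.
  - by move/eqP; rewrite hub_eq_elt.
  - by case=> j /eqP; rewrite -val_eqE /= => e; have := ltn_ord j; lia.
  - by move/eqP; rewrite hub_eq_elt.
  - by case=> j /eqP; rewrite -val_eqE /= => e; have := ltn_ord j; lia.
rewrite /sets_of; case: pickP => [j /eqP /inx [/eqP|]|no_set].
- by rewrite setv_eq_elt.
- by case=> i /setv_inj ->.
case: pickP => [[y j] /= /andP[/eqP/inx[/elt_inj -> //|]]|no_elt].
  by case=> i /esym/eqP; rewrite setv_eq_elt.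
case: (inx _ fu) => [eu|[j eu _]]; last first.
  by have := no_set j; rewrite -eu fu eqxx.
by have [j _ jx] := covT x; have := no_elt (x, j); rewrite /= -eu fu eqxx jx.
Qed.

Definition red_cvd : {set 'I_(gorder G)} :=
  [set v : 'I_(gorder G) | m <= v].

Lemma red_cvd_set : cvd_set red_cvd.
Proof.
move=> u v Mu Mv /connectP[[|w p] /=]; first by move=> _ ->; rewrite eqxx.
move=> /andP[/and3P[]]; rewrite !inE -!ltnNge => + lt_u lt_w _ _ _.
by rewrite /= red_adj_lt.
Qed.

Lemma card_red_cvd : #|red_cvd| = n.+2.
Proof.
have -> : red_cvd = [set rshift m x | x : 'I_(2 + n)].
  apply/setP => v; rewrite inE; case: (split_ordP v) => [j ->|w ->].
    rewrite leqNgt /= ltn_ord; apply/esym/negbTE/imsetP => -[w _ /eqP].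
    by rewrite -val_eqE /=; have := ltn_ord j; lia.
  by rewrite imset_f //= leq_addr.
by rewrite card_imset ?card_ord //; exact: rshift_inj.
Qed.

End RedGraph.

Definition matrix_rows m n (f : 'I_m -> 'I_n -> bool) : seq (seq bool) :=
  [seq [seq f i j | j <- enum 'I_n] | i <- enum 'I_m].

Lemma enc_rowE n (f : 'I_n -> bool) : enc_row f = enc_bits [seq f j | j <- enum 'I_n].
Proof. by rewrite /enc_bits -map_comp. Qed.

Lemma enc_matrixE m n (f : 'I_m -> 'I_n -> bool) :
  enc_matrix f = enc_rows (matrix_rows f).
Proof.
by rewrite /enc_rows -map_comp /enc_matrix; congr enc_list; apply: eq_map => i;
  rewrite enc_rowE.
Qed.

Lemma map_enum_val (T : Type) n (f : nat -> T) :
  [seq f (val i) | i <- enum 'I_n] = [seq f i | i <- iota 0 n].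
Proof. by rewrite -val_enum_ord -map_comp. Qed.

Lemma map_all_eq (T : eqType) (U : Type) (f : T -> U) c s :
  {in s, forall x, f x = c} -> map f s = nseq (size s) c.
Proof.
elim: s => //= x s IHs fc; rewrite fc ?mem_head // IHs // => y sy.
by apply: fc; rewrite inE sy orbT.
Qed.

Lemma iota_vertices m n :
  iota 0 (m + (2 + n)) = iota 0 m ++ m :: m.+1 :: [seq m.+2 + x | x <- iota 0 n].
Proof. by rewrite iotaD /= add0n -iotaDl addn0. Qed.

Definition row_inc (rows : seq (seq bool)) (i x : nat) : bool :=
  nth false (nth [::] (rev rows) i) x.

Lemma red_matrixE (n : nat) rows : all (fun r => size r == n) rows ->
  let m := size rows in
  matrix_rows (fun i j : 'I_(m + (2 + n)) => red_adj m (row_inc rows) i j) =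
  red_matrix n rows.
Proof.
move=> size_rows m.
have size_nth i : i < m -> size (nth [::] (rev rows) i) = n.
  move=> lt_i; apply/eqP; apply: (allP size_rows).
  by rewrite -mem_rev mem_nth ?size_rev.
rewrite /matrix_rows (map_enum_val _ (fun i =>
  [seq red_adj m (row_inc rows) i (val j) | j <- enum 'I_(m + (2 + n))])).
under eq_map => i do rewrite (map_enum_val _ (red_adj m (row_inc rows) i))
  iota_vertices map_cat /= -map_comp.
rewrite iota_vertices map_cat /= -map_comp /red_matrix.
have sumE x : m.+2 + x - m.+2 = x by lia.
congr (_ ++ _ :: _ :: _).
- rewrite -[X in _ = map _ X](mkseq_nth [::]) size_rev /mkseq -map_comp.
  apply/eq_in_map => i; rewrite mem_iota /= add0n => lt_i; rewrite /set_row.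
  congr (_ ++ _ :: _ :: _); rewrite ?/red_adj ?/red_edge.
  + rewrite (@map_all_eq _ _ _ false) ?size_iota // => j.
    by rewrite mem_iota => lt_j; lia.
  + by lia.
  + by lia.
  + rewrite -[RHS](mkseq_nth false) size_nth // /mkseq.
    apply: eq_map => x /=; rewrite sumE -/(row_inc rows i x).
    by case: (row_inc rows i x); lia.
- rewrite (@map_all_eq _ _ _ true) ?size_iota; last first.
    by move=> j; rewrite mem_iota /red_adj /red_edge => lt_j; lia.
  congr (_ ++ _ :: _ :: _); rewrite ?/red_adj ?/red_edge; try by lia.
  rewrite (@map_all_eq _ _ _ false) ?size_iota // => x _ /=.
  by lia.
- rewrite (@map_all_eq _ _ _ true) ?size_iota; last first.
    by move=> j; rewrite mem_iota /red_adj /red_edge => lt_j; lia.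
  congr (_ ++ _ :: _ :: _); rewrite ?/red_adj ?/red_edge; try by lia.
  rewrite (@map_all_eq _ _ _ false) ?size_iota // => x _ /=.
  by lia.
- apply: eq_map => x /=; rewrite /red_adj /red_edge.
  congr (_ ++ _).
    rewrite -[X in _ = map _ X](mkseq_nth [::]) size_rev /mkseq -map_comp.
    apply/eq_in_map => i; rewrite mem_iota /= add0n sumE => lt_i.
    rewrite -/(row_inc rows i x); case: (row_inc rows i x); lia.
  congr (_ :: _ :: _); try by lia.
  rewrite (@map_all_eq _ _ _ false) ?size_iota // => y _ /=.
  by lia.
Qed.

Lemma red_maskE m n inc :
  [seq v \in @red_cvd m n inc | v <- enum 'I_(m + (2 + n))] = red_mask m n.
Proof.
under eq_map => v do rewrite inE.
rewrite (map_enum_val _ (leq m)) iota_vertices map_cat /= /red_mask.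
congr (_ ++ _).
  rewrite (@map_all_eq _ _ _ false) ?size_iota // => j.
  by rewrite mem_iota => lt_j; lia.
rewrite leqnn leqnSn -map_comp; congr (_ :: _ :: _).
by rewrite (@map_all_eq _ _ _ true) ?size_iota // => x _ /=; lia.
Qed.

Definition sc_rows (i : set_cover_instance) : seq (seq bool) :=
  matrix_rows (fun j x => x \in @sc_family i j).

Lemma size_matrix_rows m n (f : 'I_m -> 'I_n -> bool) : size (matrix_rows f) = m.
Proof. by rewrite size_map size_enum_ord. Qed.

Lemma all_size_matrix_rows m n (f : 'I_m -> 'I_n -> bool) :
  all (fun r => size r == n) (matrix_rows f).
Proof. by apply/allP => _ /mapP[i _ ->]; rewrite size_map size_enum_ord. Qed.

(* The empty set prepended to the family is the set with no element used by
   [dominator_coloring_cover]; it comes last after reversal. *)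
Definition sc_rows0 i := nseq (sc_universe i) false :: sc_rows i.

Lemma all_size_sc_rows0 i : all (fun r => size r == sc_universe i) (sc_rows0 i).
Proof. by rewrite /= size_nseq eqxx all_size_matrix_rows. Qed.

Definition red_dc (i : set_cover_instance) : dc_instance :=
  (red_graph (size (sc_rows0 i)) (sc_universe i) (row_inc (sc_rows0 i)),
   red_budget (sc_universe i) (sc_budget i) (sc_rows0 i)).

Lemma red_dc_cvd_set i : cvd_set (red_cvd _ _ _ : {set 'I_(gorder (red_dc i).1)}).
Proof. exact: red_cvd_set. Qed.

Definition red_dc_cvd (i : set_cover_instance) : dc_cvd_instance :=
  DcCvdInstance (@red_dc_cvd_set i).

Lemma enc_red_dc i : enc_dc (red_dc i) =
  Node (enc_nat (red_budget (sc_universe i) (sc_budget i) (sc_rows0 i)))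
       (enc_rows (red_matrix (sc_universe i) (sc_rows0 i))).
Proof. by rewrite /enc_dc enc_matrixE -red_matrixE // all_size_sc_rows0. Qed.

Lemma enc_red_dc_cvd i : enc_dc_cvd (red_dc_cvd i) =
  Node (enc_bits (red_mask (size (sc_rows0 i)) (sc_universe i)))
       (enc_dc (red_dc i)).
Proof. by rewrite /enc_dc_cvd enc_rowE red_maskE. Qed.

Lemma enc_set_coverE i : enc_set_cover i =
  Node (enc_nat (sc_budget i)) (Node (enc_nat (sc_universe i)) (enc_rows (sc_rows i))).
Proof. by rewrite /enc_set_cover enc_matrixE. Qed.

Lemma nth_sc_row i j (x : 'I_(sc_universe i)) :
  nth false [seq y \in @sc_family i j | y <- enum 'I_(sc_universe i)] x =
  (x \in @sc_family i j).
Proof. by rewrite (nth_map x) ?size_enum_ord // nth_ord_enum. Qed.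

Lemma row_incP i (a : 'I_(size (sc_rows0 i))) (x : 'I_(sc_universe i)) :
  row_inc (sc_rows0 i) a x -> exists2 j, x \in @sc_family i j &
    nth [::] (rev (sc_rows0 i)) a =
    [seq y \in @sc_family i j | y <- enum 'I_(sc_universe i)].
Proof.
rewrite /row_inc; have : nth [::] (rev (sc_rows0 i)) a \in sc_rows0 i.
  by rewrite -mem_rev mem_nth // size_rev.
rewrite in_cons => /orP[/eqP ->|/mapP[j _ ->]]; first by rewrite nth_nseq if_same.
by rewrite nth_sc_row; exists j.
Qed.

Lemma set_cover_yesP i : set_cover_yes i <->
  exists2 J : {set 'I_(size (sc_rows0 i))}, #|J| <= sc_budget i &
    covers (sc_universe i) (row_inc (sc_rows0 i)) J.
Proof.
pose row j := [seq y \in @sc_family i j | y <- enum 'I_(sc_universe i)].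
split=> [[J [leJ covJ]]|[J leJ covJ]].
  have mem_row j : row j \in rev (sc_rows0 i).
    by rewrite mem_rev inE map_f ?orbT // mem_enum.
  have lt_row j : index (row j) (rev (sc_rows0 i)) < size (sc_rows0 i).
    by rewrite -size_rev index_mem.
  exists [set Ordinal (lt_row j) | j in J].
    exact: leq_trans (leq_imset_card _ _) leJ.
  move=> x; have : x \in \bigcup_(j in J) sc_family j by rewrite covJ inE.
  case/bigcupP => j Jj xj; exists (Ordinal (lt_row j)); first exact: imset_f.
  by rewrite /row_inc /= nth_index // nth_sc_row.
pose choice (a : 'I_(size (sc_rows0 i))) :=
  [pick j | row j == nth [::] (rev (sc_rows0 i)) a].
exists [set j | Some j \in choice @: J]; split.
  apply: leq_trans leJ; apply: leq_trans (leq_imset_card choice J).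
  rewrite -(card_imset _ (@Some_inj _)); apply: subset_leq_card.
  by apply/subsetP => _ /imsetP[j + ->]; rewrite inE.
apply/setP => x; rewrite inE; apply/bigcupP.
have [a Ja /row_incP[j xj nth_a]] := covJ x.
have ch : choice a = [pick j' | row j' == row j] by rewrite /choice nth_a.
move: ch; case: pickP => [j' /eqP eq_row ch|/(_ j)]; last by rewrite eqxx.
exists j'; first by rewrite inE -ch imset_f.
by rewrite -nth_sc_row -/(row j') eq_row nth_sc_row.
Qed.

Lemma red_dc_yes i : dc_yes (red_dc i) <-> set_cover_yes i.
Proof.
rewrite set_cover_yesP /dc_yes /red_dc /red_budget.
pose m := size (sc_rows0 i); set n := sc_universe i; set rows := sc_rows0 i.
have coveredP : reflect (covers n (row_inc rows) [set: 'I_m])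
    (all (has id) (element_rows n (rev rows))).
  apply: (iffP allP) => [cov x|cov _ /mapP[x lt_x ->]].
    have /cov : [seq nth false r x | r <- rev rows] ++ nseq n.+2 false \in
        element_rows n (rev rows).
      by apply/mapP; exists (val x); rewrite ?mem_iota ?ltn_ord.
    rewrite has_cat has_nseq andbF orbF has_map => /hasP[r rr rx].
    have lt_r : index r (rev rows) < m by rewrite -(size_rev rows : _ = m) index_mem.
    exists (Ordinal lt_r); first by rewrite inE.
    by rewrite /row_inc /= nth_index.
  move: lt_x; rewrite mem_iota add0n => lt_x; have [a _ ax] := cov (Ordinal lt_x).
  rewrite has_cat has_map; apply/orP; left; apply/hasP.
  by exists (nth [::] (rev rows) a) => //; rewrite mem_nth // size_rev.
case: coveredP => cov; split.
- case=> f dom_f; have lt_m : m.-1 < m by [].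
  apply: (@dominator_coloring_cover m n _ (sc_budget i) (Ordinal lt_m)) dom_f => // x.
  by rewrite /row_inc /= nth_rev //= subnn /= nth_nseq if_same.
- by case=> J leJ covJ; apply: cover_dominator_coloring leJ covJ.
- case=> f _; have lt_m : 0 < m + (2 + n) by [].
  by case: (f (Ordinal lt_m)).
- case=> J leJ covJ; case: cov => x; have [a _ ax] := covJ x.
  by exists a; rewrite ?inE.
Qed.

Lemma tree_size_gt0 t : 0 < tree_size t.
Proof. by case: t. Qed.

Lemma tree_size_enc_nat n : tree_size (enc_nat n) = (2 * n).+1.
Proof. by elim: n => //= n ->; lia. Qed.

Lemma size_le_enc_list s : size s <= tree_size (enc_list s).
Proof. by elim: s => //= t s IHs; lia. Qed.

Lemma tree_size_enc_bits r : tree_size (enc_bits r) <= 4 * size r + 1.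
Proof. by elim: r => // -[] r IHr; rewrite /= -/(enc_bits r); lia. Qed.

Lemma tree_size_enc_rows k s : all (fun r => size r == k) s ->
  tree_size (enc_rows s) <= size s * (4 * k + 2) + 1.
Proof.
elim: s => // r s IHs /= /andP[/eqP size_r /IHs]; rewrite -/(enc_rows s).
by have := tree_size_enc_bits r; rewrite size_r; lia.
Qed.

Lemma set_cover_size_bounds i :
  sc_universe i + sc_nsets i + sc_budget i < tree_size (enc_set_cover i).
Proof.
rewrite enc_set_coverE /= !tree_size_enc_nat.
have := size_le_enc_list (map enc_bits (sc_rows i)).
by rewrite size_map size_matrix_rows -/(enc_rows _); lia.
Qed.

Lemma tree_size_enc_red_dc_cvd i :
  tree_size (enc_dc_cvd (red_dc_cvd i)) <= 100 * tree_size (enc_set_cover i) ^ 2.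
Proof.
rewrite enc_red_dc_cvd /=.
have := tree_size_enc_bits (red_mask (size (sc_rows0 i)) (sc_universe i)).
rewrite size_cat !size_nseq.
have := tree_size_enc_rows
  (all_size_matrix_rows (@adj (red_graph (size (sc_rows0 i)) (sc_universe i)
                                 (row_inc (sc_rows0 i))))).
rewrite -enc_matrixE size_matrix_rows tree_size_enc_nat.
have : red_budget (sc_universe i) (sc_budget i) (sc_rows0 i) <= (sc_budget i).+3.
  by rewrite /red_budget; case: ifP.
have := set_cover_size_bounds i.
rewrite /= size_matrix_rows.
nia.
Qed.

Lemma tree_size_enc_red_dc i :
  tree_size (enc_dc (red_dc i)) <= 100 * tree_size (enc_set_cover i) ^ 2.
Proof.
by apply: leq_trans (tree_size_enc_red_dc_cvd i);
  rewrite enc_red_dc_cvd [X in _ <= X]/= -addSn leq_addl.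
Qed.

Lemma exec_reduction (cvd : bool) i : exists2 t,
  t <= 6400 * tree_size (enc_set_cover i) ^ 2 &
  exec (reduction_prog (if cvd then dc_cvd_expr else dc_expr))
    (input_store (enc_set_cover i)) t
    (input_store (if cvd then enc_dc_cvd (red_dc_cvd i) else enc_dc (red_dc i))).
Proof.
rewrite enc_red_dc_cvd enc_red_dc {2}enc_set_coverE.
have [t le_t ex_t] := run_reduction (sc_budget i) cvd
  (all_size_matrix_rows (fun j x => x \in @sc_family i j)).
exists t => //; apply: leq_trans le_t _; rewrite size_matrix_rows.
apply: (@leq_trans (400 * (4 * tree_size (enc_set_cover i)) ^ 2)).
  by rewrite leq_mul2l leq_sqr; have := set_cover_size_bounds i; lia.
by rewrite expnMn mulnA.
Qed.

Lemma exec_gt0 c s t s' : exec c s t s' -> 0 < t.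
Proof. by elim=> *; lia. Qed.

Local Open Scope ring_scope.

Lemma in_Ostar_base_gt0 (R : realType) I (enc : I -> tree) yes (par : I -> nat -> Prop)
    (b : R) i : par i 1%N -> in_Ostar enc yes par b -> 0 < b.
Proof.
move=> par1 [p [C [d /(_ i)[t [s [/exec_gt0 t_gt0 _ /(_ _ par1)]]]]]].
rewrite expr1 ltNge => le_t; apply/negP => b_le0.
have : (0 : R) < t%:R by rewrite ltr0n.
rewrite ltNge (le_trans le_t) // mulr_ge0_le0 // mulr_ge0 ?ler0n //.
by rewrite exprn_ge0 // ler0n.
Qed.

Lemma in_Ostar_reduction (R : realType) I J (encI : I -> tree) (encJ : J -> tree)
    (yesI : I -> Prop) (yesJ : J -> Prop) (parI : I -> nat -> Prop)
    (parJ : J -> nat -> Prop) (f : I -> J) (red : cmd) (c d e : nat) (b : R) :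
  (forall i, exists2 t, (t <= c * tree_size (encI i) ^ d)%N &
     exec red (input_store (encI i)) t (input_store (encJ (f i)))) ->
  (forall i, (tree_size (encJ (f i)) <= c * tree_size (encI i) ^ d)%N) ->
  (forall i, yesJ (f i) <-> yesI i) ->
  (forall i k, parI i k -> parJ (f i) (k + e)%N) ->
  0 <= b <= 2 ->
  in_Ostar encJ yesJ parJ b -> in_Ostar encI yesI parI (Num.max 1 b).
Proof.
move=> exec_red size_red yes_red par_red /andP[b_ge0 b_le2] [p [C [D decJ]]].
exists (Seq red p), (c + C * c ^ D * 2 ^ e)%N, (d + d * D)%N => i.
have [t1 le_t1 ex1] := exec_red i; have [t2 [s [ex2 ans le_t2]]] := decJ (f i).
exists (t1 + t2)%N, s; split; first exact: ExecSeq ex1 ex2.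
  by rewrite ans.
move=> k /par_red /le_t2 {}le_t2; set N := tree_size (encI i).
set B := Num.max 1 b.
have B_ge1 : 1 <= B by rewrite le_max lexx.
have B_ge0 : 0 <= B := le_trans ler01 B_ge1.
have N_gt0 : (0 < N)%N by exact: tree_size_gt0.
have Nx_ge1 a : (1 : R) <= (N ^ a)%:R by rewrite ler1n expn_gt0 N_gt0.
have le_t1' : (t1%:R : R) <= c%:R * (N ^ (d + d * D))%:R * B ^+ k.
  rewrite (@le_trans _ _ (c * N ^ (d + d * D))%:R) //.
    by rewrite ler_nat (leq_trans le_t1) // leq_mul2l leq_pexp2l ?orbT ?leq_addr.
  by rewrite natrM ler_peMr ?mulr_ge0 ?ler0n // exprn_ege1.
have le_size : ((tree_size (encJ (f i)))%:R : R) ^+ D <=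
    (c ^ D)%:R * (N ^ (d + d * D))%:R.
  apply: (@le_trans _ _ ((c * N ^ d)%:R ^+ D)).
    by rewrite lerXn2r ?nnegrE ?ler0n // ler_nat.
  by rewrite -natrX -natrM ler_nat expnMn -expnM leq_mul2l leq_pexp2l ?orbT ?leq_addl.
have le_b : b ^+ (k + e) <= (2 ^ e)%:R * B ^+ k.
  rewrite exprD mulrC natrX ler_pM ?exprn_ge0 ?lerXn2r ?nnegrE //.
  by rewrite le_max lexx orbT.
rewrite -natrX !natrD mulrDl mulrDl; apply: lerD => //.
apply: le_trans le_t2 _.
have -> : (C * c ^ D * 2 ^ e)%:R * (N ^ (d + d * D))%:R * B ^+ k =
  C%:R * ((c ^ D)%:R * (N ^ (d + d * D))%:R) * ((2 ^ e)%:R * B ^+ k) :> R.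
  by rewrite !natrM -!mulrA; congr (_ * (_ * _)); rewrite mulrCA.
by rewrite ler_pM ?mulr_ge0 ?exprn_ge0 ?ler0n // ler_wpM2l.
Qed.

Lemma set_cover_conjecture_reduction (R : realType) J (encJ : J -> tree)
    (yesJ : J -> Prop) (parJ : J -> nat -> Prop) (f : set_cover_instance -> J)
    (red : cmd) (c d e : nat) (j : J) (eps : R) :
  (forall i, exists2 t, (t <= c * tree_size (enc_set_cover i) ^ d)%N &
     exec red (input_store (enc_set_cover i)) t (input_store (encJ (f i)))) ->
  (forall i, (tree_size (encJ (f i)) <= c * tree_size (enc_set_cover i) ^ d)%N) ->
  (forall i, yesJ (f i) <-> set_cover_yes i) ->
  (forall i, parJ (f i) (sc_universe i + e)%N) ->
  parJ j 1%N -> set_cover_conjecture R -> 0 < eps ->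
  ~ in_Ostar encJ yesJ parJ (2 - eps).
Proof.
move=> exec_red size_red yes_red par_red par1 scc eps_gt0 decJ.
have b_gt0 := in_Ostar_base_gt0 par1 decJ.
apply: (scc (2 - Num.max 1 (2 - eps))).
  by rewrite subr_gt0 gt_max ltr1n ltrBlDr ltrDl eps_gt0.
rewrite subKr; apply: in_Ostar_reduction exec_red size_red yes_red _ _ decJ.
  by move=> i k ->.
by rewrite (ltW b_gt0) lerBlDr lerDl ltW.
Qed.

Definition point_graph : graph :=
  @Graph 1 (fun _ _ => false) (fun _ _ => erefl) (fun _ => erefl).

Lemma point_cvd_set : cvd_set [set: 'I_(gorder (point_graph, 0%N).1)].
Proof. by move=> u v; rewrite inE. Qed.

Theorem theorem15 (R : realType) :
  set_cover_conjecture R ->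
  forall eps : R, (0 < eps)%R ->
    ~ in_Ostar enc_dc dc_yes dc_cvd_size (2 - eps)%R /\
    ~ in_Ostar enc_dc_cvd (fun i => dc_yes (dcm_instance i))
        (fun i k => k = #|dcm_set i|) (2 - eps)%R.
Proof.
move=> scc eps eps_gt0.
have le_c i : (100 * tree_size (enc_set_cover i) ^ 2 <=
    6400 * tree_size (enc_set_cover i) ^ 2)%N by rewrite leq_mul2r orbT.
split.
- apply: (set_cover_conjecture_reduction (f := red_dc) (c := 6400) (d := 2)
    (e := 2) (j := (point_graph, 0%N))) scc eps_gt0.
  + exact: exec_reduction false.
  + by move=> i; apply: leq_trans (tree_size_enc_red_dc i) (le_c i).
  + exact: red_dc_yes.
  + move=> i; exists (red_cvd _ _ _); split; first exact: red_cvd_set.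
    by rewrite card_red_cvd addn2.
  + exists [set: 'I_1]; split; first exact: point_cvd_set.
    by rewrite cardsT card_ord.
- apply: (set_cover_conjecture_reduction (f := red_dc_cvd) (c := 6400) (d := 2)
    (e := 2) (j := DcCvdInstance point_cvd_set)) scc eps_gt0.
  + exact: exec_reduction true.
  + by move=> i; apply: leq_trans (tree_size_enc_red_dc_cvd i) (le_c i).
  + exact: red_dc_yes.
  + by move=> i; rewrite addn2; apply/esym/card_red_cvd.
  + by rewrite /= cardsT card_ord.
Qed.
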